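(* Let $(V_1,\dots,V_n)$ be a $Q$-commuting tuple of isometries acting on a Hilbert space $\mathcal{H}$. Then $\mathcal{H}$ admits an orthogonal decomposition $\mathcal{H}=\mathcal{H}(s)\oplus\left(\bigoplus_{1\le j\le n+1}\mathcal{H}_j\right)$ such that the following hold. (1) $\mathcal{H}_1,\dots,\mathcal{H}_{n+1},\mathcal{H}(s)$ are joint reducing subspaces for $V_1,\dots,V_n$ and $Q$. (2) $V_i|_{\mathcal{H}_j}$ is either a unitary or a pure isometry for $1\le i\le n$ and $1\le j\le n+1$. (3) If $\widetilde\Theta_n$ is the set of all functions $\widetilde\theta:\{1,\dots,n\}\to\{A_u,A_{shift}\}$ such that at least $n-1$ of the values $\widetilde\theta(1),\dots,\widetilde\theta(n)$ are $A_u$, then for every $\widetilde\theta\in\widetilde\Theta_n$ there is a unique maximal joint reducing subspace $\mathcal{H}_t$ ($1\le t\le n+1$) for $V_1,\dots,V_n,Q$ such that the $k$-th component of $(V_1|_{\mathcal{H}_t},\dots,V_n|_{\mathcal{H}_t})$ is of the type $\widetilde\theta(k)$ for $1\le k\le n$. (4) $(V_1|_{\mathcal{H}(s)},\dots,V_n|_{\mathcal{H}(s)})$ is a strongly pure isometry $Q$-commuting tuple. One or more subspaces in the decomposition may coincide with the subspace $\{0\}$.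
   Context: All operators are bounded linear maps on complex Hilbert spaces. A tuple $(V_1,\dots,V_n)$ of operators on $\mathcal{H}$ is $Q$-commuting if there is a commuting family $Q=\{Q_{ij}\in\mathcal{B}(\mathcal{H}): Q_{ij}=Q_{ji}^*,\ i\ne j\}$ of unitaries such that $V_iV_j=Q_{ij}V_jV_i$ and $V_kQ_{ij}=Q_{ij}V_k$ for all $i\ne j$ and all $k$. A closed subspace is a joint reducing subspace for $V_1,\dots,V_n$ and $Q$ if it reduces every $V_i$ and every $Q_{ij}$. A pure isometry (unilateral shift) is an isometry $V$ with $V^{*n}x\to0$ as $n\to\infty$ for every $x$. Type $A_u$ means unitary; type $A_{shift}$ means pure isometry. An operator on the zero space is allowed to be of either type. A $Q$-commuting tuple $(V_1,\dots,V_n)$ is a strongly pure isometry tuple if each $V_j$ is an isometry and every joint reducing subspace $\mathcal{L}$ for $V_1,\dots,V_n$ and $Q$ such that at least $n-1$ of $V_1|_{\mathcal{L}},\dots,V_n|_{\mathcal{L}}$ are unitaries is $\mathcal{L}=\{0\}$. (For the tuple restricted to a joint reducing subspace, $Q$ is restricted to that subspace as well.) *)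

(* Defs.v *)
From HB Require Import structures.
From mathcomp Require Import all_boot all_order all_algebra complex.
From mathcomp Require Import all_classical all_reals.
From mathcomp Require Import topology normedtype.

Set Implicit Arguments.
Unset Strict Implicit.
Unset Printing Implicit Defensive.

Import Order.TTheory GRing.Theory Num.Theory.
Import numFieldNormedType.Exports.

Local Open Scope classical_set_scope.
Local Open Scope ring_scope.

(* The inner product is linear in its first argument and conjugate-linear in
   its second one. *)
HB.mixin Record CompleteNormedModule_isHilbert (R : realType) H
    & CompleteNormedModule R[i] H := {
  inner : {dot H for (@Num.conj R[i])};
  sqr_norm_inner : forall x : H, `|x| ^+ 2 = inner x x
}.

#[short(type="hilbertType")]
HB.structure Definition Hilbert (R : realType) :=
  {H of CompleteNormedModule R[i] H & CompleteNormedModule_isHilbert R H}.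

Notation "<| x , y |>" := (inner x y) (at level 0, x at level 69, y at level 69,
  format "<| x ,  y |>") : ring_scope.

Record bounded_operator (R : realType) (H : hilbertType R) := BoundedOperator {
  bop :> {linear H -> H};
  bopP : exists M : R[i], forall x : H, `|bop x| <= M * `|x|
}.

Section Subspaces.
Variables (R : realType) (H : hilbertType R).
Implicit Types (K L M : set H) (T : H -> H) (x y : H).

Definition closed_subspace L := closed L /\ submod_closed [in L].

Definition orthogonal_sets L M := forall x y, L x -> M y -> <|x, y|> = 0.

(* K (-) M, the orthocomplement of M relative to K. *)
Definition ominus K M := [set x | K x /\ forall y, M y -> <|x, y|> = 0].

(* The internal orthogonal direct sum of L and the L_ j is the whole space. *)
Definition orthogonal_decomposition (m : nat) L (L_ : 'I_m -> set H) :=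
  [/\ closed_subspace L /\ (forall j, closed_subspace (L_ j)),
      forall j, orthogonal_sets L (L_ j),
      forall j k, j != k -> orthogonal_sets (L_ j) (L_ k) &
      forall x, exists y (z : 'I_m -> H),
        [/\ L y, forall j, L_ j (z j) & x = y + \sum_j z j]].

(* From here on, notions about an operator carry a closed subspace K and speak
   about its restriction to K; K = setT gives the notion for the operator
   itself. *)

Definition maps_to K T := forall x, K x -> K (T x).

(* S restricted to K is (T|_K)^*. Since S is the adjoint computed inside K, it
   is unique on K. *)
Definition adjoint_on K T (S : H -> H) :=
  maps_to K S /\ forall x y, K x -> K y -> <|T x, y|> = <|x, S y|>.

Definition isometry_on K T :=
  maps_to K T /\ forall x, K x -> `|T x| = `|x|.

Definition unitary_on K T :=
  maps_to K T /\
  exists2 S, adjoint_on K T S & forall x, K x -> S (T x) = x /\ T (S x) = x.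

Definition pure_isometry_on K T :=
  isometry_on K T /\
  exists2 S, adjoint_on K T S &
    forall x, K x -> (fun m : nat => iter m S x) @ \oo --> (0 : H).

Definition reduces_on K T M :=
  [/\ closed_subspace M, M `<=` K, maps_to M T & maps_to (ominus K M) T].

End Subspaces.

Section Tuples.
Variables (R : realType) (H : hilbertType R) (n : nat).
Implicit Types (K M : set H).
Implicit Types (V : 'I_n -> bounded_operator H).
(* The diagonal entries Q i i are never used. *)
Implicit Types (Q : 'I_n -> 'I_n -> bounded_operator H).

Definition Q_commuting_on K V Q :=
  [/\ forall i, maps_to K (V i),
      forall i j, i != j -> unitary_on K (Q i j) /\ adjoint_on K (Q j i) (Q i j),
      forall i j k l, i != j -> k != l ->
        forall x, K x -> Q i j (Q k l x) = Q k l (Q i j x),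
      forall i j, i != j -> forall x, K x -> V i (V j x) = Q i j (V j (V i x)) &
      forall i j k, i != j -> forall x, K x -> V k (Q i j x) = Q i j (V k x)].

Definition joint_reducing_on K V Q M :=
  [/\ closed_subspace M /\ M `<=` K,
      forall i, reduces_on K (V i) M &
      forall i j, i != j -> reduces_on K (Q i j) M].

Definition strongly_pure_on K V Q :=
  [/\ Q_commuting_on K V Q,
      forall i, isometry_on K (V i) &
      forall M, joint_reducing_on K V Q M ->
        (n.-1 <= #|[pred i | `[< unitary_on M (V i) >]]|)%N ->
        M = [set 0]].

End Tuples.

Inductive op_type := A_u | A_shift.

Definition is_A_u (t : op_type) := if t is A_u then true else false.

Definition Theta (n : nat) : set ('I_n -> op_type) :=
  [set theta | (n.-1 <= #|[pred i | is_A_u (theta i)]|)%N].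
Arguments Theta n : clear implicits.

Section Types.
Variables (R : realType) (H : hilbertType R) (n : nat).
Implicit Types (K M : set H) (V : 'I_n -> bounded_operator H).
Implicit Types (Q : 'I_n -> 'I_n -> bounded_operator H).
Implicit Types (theta : 'I_n -> op_type).

Definition of_type_on K (T : H -> H) (t : op_type) :=
  match t with
  | A_u => unitary_on K T
  | A_shift => pure_isometry_on K T
  end.

Definition joint_reducing_of_type V Q theta M :=
  joint_reducing_on setT V Q M /\ forall k, of_type_on M (V k) (theta k).

Definition maximal_joint_reducing_of_type V Q theta M :=
  joint_reducing_of_type V Q theta M /\
  forall M', joint_reducing_of_type V Q theta M' -> M `<=` M' -> M' = M.

End Types.

(* Main.v *)
Require Import Defs.
From mathcomp Require Import all_boot all_order all_algebra complex.
From mathcomp Require Import all_classical all_reals.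
From mathcomp Require Import topology normedtype sequences.
From mathcomp Require Import ring lra.

(* For each type theta, let H_theta be the set of all x such that every word in
   the V_i, the V_i^* and the Q_ij sends x to a vector on which V_k V_k^* = 1
   (theta k unitary) or V_k^{*m} -> 0 (theta k a shift), for every k.  This is a
   closed joint reducing subspace of type theta, and it contains every other
   one.  For distinct types the H_theta are orthogonal, because
   <x, y> = <V_k^{*m} x, V_k^{*m} y> -> 0 when V_k is unitary at x and a shift
   at y.  Let H(s) be the orthocomplement of all of them.

   If M in H(s) is joint reducing and V_i is unitary on M for all i <> k, then
   the vectors of M lying in V_k^m M for all m form an invariant set on which
   all V_i are unitary, so it is 0.  For x in M the projections V_k^m V_k^{*m} x
   converge to such a vector; hence V_k^{*m} x -> 0 and M lies in the part where
   only V_k is a shift, so M = 0. *)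

Set Implicit Arguments.
Unset Strict Implicit.
Unset Printing Implicit Defensive.
Import Order.TTheory GRing.Theory Num.Theory.
Import numFieldNormedType.Exports.
Local Open Scope classical_set_scope.
Local Open Scope ring_scope.

Lemma closed_singleton (K : numFieldType) (U : normedModType K) (u : U) :
  closed [set u].
Proof.
apply: accessible_closed_set1; apply: hausdorff_accessible.
exact: norm_hausdorff.
Qed.

(** * Inner product identities, the Cauchy-Schwarz inequality and convergence criteria *)

Section InnerProduct.
Local Open Scope complex_scope.
Variables (R : realType) (H : hilbertType R).
Implicit Types (x y z : H).

Lemma innerC x y : <|x, y|> = Num.conj <|y, x|>.
Proof. by rewrite hermC mul1r. Qed.

Lemma inner_eq0C x y : <|x, y|> = 0 -> <|y, x|> = 0.
Proof. by move=> xy; rewrite innerC xy rmorph0. Qed.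

Lemma innerZl a x y : <|a *: x, y|> = a * <|x, y|>.
Proof. exact: linearZl_LR. Qed.

Lemma innerZr a x y : <|x, a *: y|> = Num.conj a * <|x, y|>.
Proof. exact: linearZr_LR. Qed.

Lemma inner_inj x y : (forall z, <|x, z|> = <|y, z|>) -> x = y.
Proof.
move=> xy; suff /eqP : `|x - y| ^+ 2 = 0.
  by rewrite expf_eq0 normr_eq0 subr_eq0 => /eqP.
by rewrite sqr_norm_inner linearBl /= xy subrr.
Qed.

Lemma parallelogram x y :
  `|x + y| ^+ 2 + `|x - y| ^+ 2 = 2 * `|x| ^+ 2 + 2 * `|y| ^+ 2.
Proof. rewrite !sqr_norm_inner hnormD hnormB; ring. Qed.

Lemma sqr_normD_orth x y : <|x, y|> = 0 ->
  `|x + y| ^+ 2 = `|x| ^+ 2 + `|y| ^+ 2.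
Proof. by move=> xy; rewrite !sqr_norm_inner hnormDd. Qed.

(** Pythagoras: the subtracted multiple of [z] is the projection of [w] onto the line of [z].
    Non-negativity of the left side gives Cauchy-Schwarz, and the exact value drives the
    minimization in [projection_image]. *)
Lemma sqr_norm_residual w z : z != 0 ->
  `|w - (<|w, z|> / `|z| ^+ 2) *: z| ^+ 2 =
  `|w| ^+ 2 - `|<|w, z|>| ^+ 2 / `|z| ^+ 2.
Proof.
move=> z0; set c := _ / _.
have nz0 : `|z| ^+ 2 != 0 by rewrite expf_eq0 normr_eq0.
have wz : <|w - c *: z, z|> = 0.
  by rewrite linearBl /= innerZl -sqr_norm_inner divfK // subrr.
have -> : `|w| ^+ 2 = `|w - c *: z| ^+ 2 + `|c *: z| ^+ 2.
  by rewrite -sqr_normD_orth ?subrK // innerZr wz mulr0.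
rewrite normrZ exprMn /c normrM exprMn normfV normrX normr_id exprVn.
have aux (a n : R[i]) : n != 0 -> a / n ^+ 2 * n = a / n by move=> n0; field.
by rewrite aux // addrK.
Qed.

Lemma cauchy_schwarz x y : `|<|x, y|>| <= `|x| * `|y|.
Proof.
have [->|y0] := eqVneq y 0; first by rewrite linear0r !normr0 mulr0.
rewrite -(@ler_pXn2r _ 2) ?nnegrE ?mulr_ge0 // exprMn.
have ny0 : 0 < `|y| ^+ 2 by rewrite exprn_gt0 // normr_gt0.
rewrite -ler_pdivrMr // -subr_ge0 -sqr_norm_residual //.
by rewrite exprn_ge0.
Qed.

Lemma inner_continuousl z : continuous (fun x => <|x, z|> : (R[i])^o).
Proof.
move=> x; apply/cvgrPdist_le => /= e e0; near=> y.
rewrite -linearBl; apply: le_trans (cauchy_schwarz _ _) _.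
(* The summand 1 keeps the divisor positive when [z] is 0. *)
have z1 : 0 < `|z| + 1 by rewrite ltr_wpDl.
apply: (@le_trans _ _ (`|x - y| * (`|z| + 1))).
  by rewrite ler_wpM2l //; rewrite lerDl.
rewrite -ler_pdivlMr //.
near: y; have /cvgrPdist_le : id y @[y --> x] --> x by exact: cvg_id.
by apply; rewrite divr_gt0 // ltr_wpDl.
Unshelve. all: by end_near. Qed.

(** Norms have values in [R[i]], whereas the bounds available are real sequences; a positive element
    of [R[i]] is real, which links the two. *)
Lemma cvg0_sqr_norm (V : normedModType R[i]) (u : nat -> V) (e : nat -> R) :
  e @ \oo --> (0 : R) -> (forall n, `|u n| ^+ 2 <= (e n)%:C) ->
  u @ \oo --> (0 : V).
Proof.
move=> e0 ue; apply/cvgr0Pnorm_lt => /= d d0.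
have dE : d = (complex.Re d)%:C by rewrite RRe_real // gtr0_real.
have d2 : 0 < complex.Re d ^+ 2 by rewrite exprn_gt0 // -ltcR -dE.
have /cvgr0Pnorm_lt/(_ _ d2) := e0.
apply: filterS => n en.
rewrite -(@ltr_pXn2r _ 2) ?nnegrE // ?(ltW d0) //.
apply: le_lt_trans (ue n) _; rewrite dE -rmorphXn /= ltcR.
exact: le_lt_trans (ler_norm _) en.
Qed.

Lemma cvg_sqr_dist (u : nat -> H) (e : nat -> R) :
  e @ \oo --> (0 : R) ->
  (forall m n, (m <= n)%N -> `|u m - u n| ^+ 2 <= (e m + e n)%:C) ->
  cvg (u @ \oo).
Proof.
move=> e0 ue; apply: cauchy_cvg; apply: cauchy_exP => /= d d0.
have dE : d = (complex.Re d)%:C by rewrite RRe_real // gtr0_real.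
have rd0 : 0 < complex.Re d by rewrite -ltcR -dE.
(* Each of [e N] and [e n] gets half of the squared radius. *)
have d2 : 0 < complex.Re d ^+ 2 / 2 by rewrite divr_gt0 ?exprn_gt0.
have /cvgrPdist_lt/(_ _ d2)[N _ eN] := e0.
exists (u N); exists N => // n /= Nn.
rewrite -ball_normE /=.
rewrite -(@ltr_pXn2r _ 2) ?nnegrE // ?(ltW d0) //.
apply: le_lt_trans (ue _ _ Nn) _.
rewrite dE -rmorphXn /= ltcR.
have := eN N (leqnn N); have := eN n Nn; rewrite /= !sub0r !normrN => h1 h2.
have := ler_norm (e n); have := ler_norm (e N); lra.
Qed.

End InnerProduct.

(** * Closed subspaces and orthogonal projection *)

Section Projection.
Local Open Scope complex_scope.
Variables (R : realType) (H : hilbertType R).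
Implicit Types (x y z : H) (K M : set H).

Lemma submod_closedP K : submod_closed [in K] ->
  [/\ K 0, forall a x, K x -> K (a *: x), forall x y, K x -> K y -> K (x + y)
    & forall x y, K x -> K y -> K (x - y)].
Proof.
move=> [K0 KP].
have KD a x y : K x -> K y -> K (a *: x + y).
  by move=> Kx Ky; apply: set_mem; exact: (KP a x y (mem_set Kx) (mem_set Ky)).
have {}K0 : K 0 := set_mem K0.
split => //.
- by move=> a x Kx; rewrite -[_ *: _]addr0; apply: KD.
- by move=> x y Kx Ky; rewrite -[x]scale1r; apply: KD.
- by move=> x y Kx Ky; rewrite addrC -scaleN1r; apply: KD.
Qed.

Lemma submod_closedI K : K 0 ->
  (forall a x y, K x -> K y -> K (a *: x + y)) -> submod_closed [in K].
Proof.
move=> K0 KP; split => [|a x y Kx Ky]; first exact: mem_set.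
by apply: mem_set; apply: KP; exact: set_mem.
Qed.

Lemma contraction_continuous (T : H -> H) :
  (forall x y, T (x - y) = T x - T y) -> (forall x, `|T x| <= `|x|) ->
  continuous T.
Proof.
move=> TB T1 x; apply/cvgrPdist_le => /= e e0; near=> y.
rewrite -TB; apply: le_trans (T1 _) _.
near: y; have /cvgrPdist_le : id y @[y --> x] --> x by exact: cvg_id.
exact.
Unshelve. all: by end_near. Qed.

(* For [T = idfun] this is the projection theorem; for [K = setT] it is what is
   needed to build the adjoint of [T].  By the parallelogram law a minimizing
   sequence of [|x - T y|] is Cauchy. *)
Lemma projection_image K (T : {linear H -> H}) x :
  closed_subspace K -> (forall v, `|T v| = `|v|) ->
  exists2 y, K y & forall z, K z -> <|x - T y, T z|> = 0.
Proof.
move=> [Kcl /submod_closedP[K0 KZ KD KB]] isoT.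
(* Real parts are taken so that the infimum lives in [R]. *)
pose D := [set complex.Re (`|x - T y| ^+ 2 : R[i]) | y in K].
have sqE (v : H) : `|v| ^+ 2 = (complex.Re (`|v| ^+ 2 : R[i]))%:C.
  by rewrite RRe_real // rpredX ?normr_real.
have hD : has_inf D.
  split; first by exists (complex.Re (`|x - T 0| ^+ 2 : R[i])), 0.
  exists 0 => _ [y _ <-]; by rewrite -lecR -sqE exprn_ge0.
pose d := inf D.
have dP y : K y -> d%:C <= `|x - T y| ^+ 2.
  by move=> Ky; rewrite sqE lecR; apply: ge_inf; [case: hD|exists y].
have /choice[u uP] n : exists y, K y /\ `|x - T y| ^+ 2 <= (d + n.+1%:R^-1)%:C.
  have n0 : 0 < n.+1%:R^-1 :> R by rewrite invr_gt0.
  have [_ [y Ky <-] ylt] := inf_adherent n0 hD.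
  by exists y; split => //; rewrite sqE lecR ltW.
have /cvg_ex[l ul] : cvg (u @ \oo).
  apply: (@cvg_sqr_dist _ _ _ (fun n => 2 * n.+1%:R^-1)) => [|m n _].
    rewrite -(mulr0 2); apply: cvgMl_tmp; exact: cvg_harmonic.
  have [[Km um] [Kn un]] := (uP m, uP n).
  have := parallelogram (x - T (u m)) (x - T (u n)).
  set w := x - T (u m) + _.
  have -> : x - T (u m) - (x - T (u n)) = - T (u m - u n).
    by rewrite opprB addrC subrKA linearB opprB.
  rewrite normrN isoT => /(canRL (addKr _)) ->.
  (* The midpoint of [u m] and [u n] lies in [K], so the squared norm of [w] is at least [4 * d];
     this is the term subtracted in the parallelogram law. *)
  have wE : w = 2 *: (x - T (2^-1 *: (u m + u n))).
    rewrite scalerBr -linearZ /= scalerA mulfV ?pnatr_eq0 //.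
    have -> : 1 *: (u m + u n) = u m + u n by exact: scale1r.
    by rewrite linearD scaler_nat mulr2n /w opprD addrACA.
  have Kmid : K (2^-1 *: (u m + u n)) by apply/KZ/KD.
  have := dP _ Kmid.
  have n4 : `|2 : R[i]| ^+ 2 = 4 by rewrite ger0_norm // -natrX.
  rewrite wE normrZ exprMn n4 -[4](rmorph_nat (real_complex R) 4).
  rewrite -[2](rmorph_nat (real_complex R) 2).
  move: um un; rewrite (sqE (x - T (u m))) (sqE (x - T (u n))).
  rewrite (sqE (x - T (_ *: _))).
  rewrite -!rmorphM -rmorphN -!rmorphD !lecR.
  have arith (a b c p q : R) : a <= d + p -> b <= d + q -> d <= c ->
    - (4 * c) + (2 * a + 2 * b) <= 2 * p + 2 * q by lra.
  exact: arith.
have Kl : K l.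
  by apply: (closed_cvg K Kcl _ _ ul); apply: nearW => n; case: (uP n).
exists l => // z Kz.
have [->|z0] := eqVneq z 0; first by rewrite linear0 linear0r.
have Tz0 : T z != 0 by rewrite -normr_eq0 isoT normr_eq0.
have lim0 : (fun n => <|x - T (u n), T z|> : (R[i])^o) @ \oo --> (0 : (R[i])^o).
  pose r := complex.Re (`|T z| ^+ 2 : R[i]).
  apply: (@cvg0_sqr_norm _ _ _ (fun n => r * n.+1%:R^-1)).
    rewrite -(mulr0 r); apply: cvgMl_tmp.
    exact: cvg_harmonic.
  move=> n; have [Ku un] := uP n.
  (* Moving [u n] by the optimal multiple of [z] stays in [K], hence cannot bring the squared
     distance below [d]. As that distance is already within [n.+1%:R^-1] of [d], the inner product
     is small. *)
  pose c := <|x - T (u n), T z|> / `|T z| ^+ 2.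
  have := dP _ (KD _ _ Ku (KZ c _ Kz)).
  rewrite linearD linearZ opprD addrA sqr_norm_residual // => dle.
  have z2 : 0 < `|T z| ^+ 2 by rewrite exprn_gt0 // normr_gt0.
  rewrite rmorphM /= /r -sqE mulrC -ler_pdivrMr //.
  rewrite -(lerD2l d%:C) -rmorphD /=; apply: le_trans un.
  by rewrite -lerBrDr.
suff lim : (fun n => <|x - T (u n), T z|> : (R[i])^o) @ \oo -->
           (<|x - T l, T z|> : (R[i])^o).
  exact: (norm_cvg_unique lim lim0).
apply: (cvg_comp (fun n => x - T (u n)) (fun v => <|v, T z|> : (R[i])^o)).
  apply: cvgB; first exact: cvg_cst.
  apply: (cvg_comp u T ul); apply: contraction_continuous => [y y'|y].
    exact: linearB.
  by rewrite isoT.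
exact: inner_continuousl.
Qed.

Lemma projection_exists K x : closed_subspace K ->
  exists2 y, K y & forall z, K z -> <|x - y, z|> = 0.
Proof. by move=> Kc; exact: (@projection_image K idfun). Qed.

End Projection.

(** * Adjoints, linear contractions and reducing subspaces *)

Section Adjoints.
Variables (R : realType) (H : hilbertType R).
Implicit Types (x y z : H) (K M : set H) (T S : H -> H).

Definition adjoint T S := forall x y, <|T x, y|> = <|x, S y|>.

Lemma adjoint_sym T S : adjoint T S -> adjoint S T.
Proof. by move=> TS x y; rewrite innerC -TS -innerC. Qed.

Lemma adjoint_linear T S : adjoint T S ->
  forall a x y, S (a *: x + y) = a *: S x + S y.
Proof.
move=> /adjoint_sym ST a x y; apply: inner_inj => z.
by rewrite linearDl /= innerZl !ST linearDl /= innerZl.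
Qed.

Definition linear_contraction T :=
  (forall a x y, T (a *: x + y) = a *: T x + T y) /\
  (forall x, `|T x| <= `|x|).

Section Contraction.
Variable T : H -> H.
Hypothesis contT : linear_contraction T.

Lemma contractionB x y : T (x - y) = T x - T y.
Proof. by rewrite addrC -scaleN1r contT.1 scaleN1r addrC. Qed.

Lemma contraction0 : T 0 = 0.
Proof. by have := contractionB 0 0; rewrite !subrr. Qed.

Lemma linear_contraction_continuous : continuous T.
Proof. exact: contraction_continuous contractionB contT.2. Qed.

Lemma linear_contraction_iter m : linear_contraction (iter m T).
Proof.
elim: m => [|m [IHl IHn]]; first by split.
split => [a x y|x] /=; first by rewrite IHl contT.1.
exact: le_trans (contT.2 _) (IHn _).
Qed.

End Contraction.

(** Polarization: expanding the norm of a sum gives equality of real parts, and replacing [x] by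
    ['i *: x] gives that of imaginary parts. *)
Lemma isometry_inner (T : {linear H -> H}) :
  (forall x, `|T x| = `|x|) -> forall x y, <|T x, T y|> = <|x, y|>.
Proof.
move=> isoT x y.
have nE u : <|T u, T u|> = <|u, u|>.
  by have := sqr_norm_inner (T u); rewrite isoT sqr_norm_inner.
have reE u v : <|T u, T v|> + Num.conj <|T u, T v|> =
               <|u, v|> + Num.conj <|u, v|>.
  have := nE (u + v); rewrite linearD !dnormD !nE; exact: addrI.
have := reE x y; have := reE ('i *: x) y.
rewrite linearZ !innerZl !rmorphM /= conjCi !mulNr -!mulrBr.
move=> /(mulfI (neq0Ci _)) h1 h2.
have : <|T x, T y|> * 2 = <|x, y|> * 2.
  transitivity ((<|T x, T y|> + Num.conj <|T x, T y|>) +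
                (<|T x, T y|> - Num.conj <|T x, T y|>)); first by ring.
  by rewrite h1 h2; ring.
by apply: mulIf; rewrite pnatr_eq0.
Qed.

(** [S y] is chosen so that [T (S y)] is the projection of [y] onto the range of [T]; then
    [<|T x, y|>] equals [<|T x, T (S y)|>], which is [<|x, S y|>]. *)
Lemma isometry_adjoint_exists (T : {linear H -> H}) :
  (forall x, `|T x| = `|x|) -> exists S, adjoint T S.
Proof.
move=> isoT; have Tc : closed_subspace (@setT H).
  by split; [exact: closedT|exact: submod_closedI].
have /choice[S SP] y : exists v, forall z, <|y - T v, T z|> = 0.
  by have [v _ vP] := projection_image y Tc isoT; exists v => z; apply: vP.
exists S => x y; apply/eqP; rewrite -subr_eq0 -(isometry_inner isoT x).
by rewrite -linearBr /= inner_eq0C ?SP.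
Qed.

Lemma isometry_adjointK (T : {linear H -> H}) S :
  (forall x, `|T x| = `|x|) -> adjoint T S -> cancel T S.
Proof.
move=> isoT TS x; apply: inner_inj => y.
by rewrite (adjoint_sym TS) isometry_inner.
Qed.

Lemma isometry_contraction (T : {linear H -> H}) :
  (forall x, `|T x| = `|x|) -> linear_contraction T.
Proof.
by move=> isoT; split => [a x y|x]; rewrite ?linearP // isoT.
Qed.

(** The squared norm of [S x] is [<|T (S x), x|>]; Cauchy-Schwarz bounds it, and one factor of the
    norm of [S x] cancels. *)
Lemma adjoint_contraction T S : linear_contraction T -> adjoint T S ->
  linear_contraction S.
Proof.
move=> [_ T1] TS; split; first exact: adjoint_linear.
move=> x; have [->|Sx0] := eqVneq (S x) 0; first by rewrite normr0.
have Sx : 0 < `|S x| by rewrite normr_gt0.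
rewrite -(ler_pM2l Sx) -expr2 sqr_norm_inner -TS.
have TSx : 0 <= <|T (S x), x|> by rewrite TS -sqr_norm_inner exprn_ge0.
rewrite -(ger0_norm TSx); apply: le_trans (cauchy_schwarz _ _) _.
by rewrite ler_wpM2r.
Qed.

Lemma adjoint_on_unique M T S S' : closed_subspace M ->
  adjoint_on M T S -> adjoint T S' -> maps_to M S' ->
  forall y, M y -> S y = S' y.
Proof.
move=> [_ /submod_closedP[_ _ _ MB]] [MS TS] TS' MS' y My.
apply/eqP; rewrite -subr_eq0 -(dnorm_eq0 (@inner _ H)).
set r := _ - _; have Mr : M r by apply: MB; [apply: MS|apply: MS'].
by rewrite {2}/r linearBr /= -TS // -TS' subrr.
Qed.

(** The residual [r] of [S y] after projection onto [M] lies in [ominus K M], and so does [T r].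
    Hence [<|r, S y|>], being [<|T r, y|>], vanishes, so [r] is orthogonal to itself. *)
Lemma reduces_maps_adjoint K T S M : closed_subspace K -> adjoint T S ->
  maps_to K S -> reduces_on K T M -> maps_to M S.
Proof.
move=> [_ /submod_closedP[_ _ _ KB]] TS KS [Mc MK _ MT] y My.
have [p Mp pP] := projection_exists (S y) Mc.
set r := S y - p in pP.
have r_om : ominus K M r by split; [apply: KB; [apply/KS/MK|apply: MK]|].
have /eqP : <|r, r|> = 0.
  rewrite {2}/r linearBr /= -TS (MT _ r_om).2 // pP // subrr //.
by rewrite (dnorm_eq0 (@inner _ H)) subr_eq0 => /eqP ->.
Qed.

Lemma maps_ominus K M T S : adjoint T S -> maps_to K T -> maps_to M S ->
  maps_to (ominus K M) T.
Proof.
move=> TS KT MS x [Kx xM]; split; first exact: KT.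
by move=> y My; rewrite TS xM //; apply: MS.
Qed.

Lemma closed_subspaceI M : closed M -> M 0 ->
  (forall a x y, M x -> M y -> M (a *: x + y)) -> closed_subspace M.
Proof. by move=> Mc M0 MP; split => //; apply: submod_closedI. Qed.

Lemma closed_eq_contraction T : linear_contraction T ->
  closed_subspace [set x | T x = x].
Proof.
move=> contT; apply: closed_subspaceI => [||a x y /= Tx Ty].
- rewrite (_ : mkset _ = (fun x => T x - x) @^-1` [set 0]).
    apply: closed_comp; last exact: closed_singleton.
    move=> x _; apply: cvgB; last exact: cvg_id.
    exact: linear_contraction_continuous.
  apply/seteqP; split => x /= => [->|/eqP]; first by rewrite subrr.
  by rewrite subr_eq0 => /eqP.
- exact: contraction0.
- by rewrite contT.1 Tx Ty.
Qed.

(** Closedness is an [e / 2] argument: all iterates are contractions, so a nearby vector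
    approximates uniformly in [m]. *)
Lemma closed_iter_cvg0 T : linear_contraction T ->
  closed_subspace [set x | (fun m => iter m T x) @ \oo --> (0 : H)].
Proof.
move=> contT; have contm := linear_contraction_iter contT.
apply: closed_subspaceI => [x xcl|/=|a x y /= Tx Ty].
- apply/cvgr0Pnorm_le => /= e e0.
  have e2 : 0 < e / 2 by rewrite divr_gt0.
  have [y [/cvgr0Pnorm_le/(_ _ e2) Ty xy]] := xcl _ (nbhsx_ballx x _ e2).
  apply: filterS Ty => m ym.
  rewrite -(subrK (iter m T y) (iter m T x)) -(contractionB (contm m)).
  apply: le_trans (ler_normD _ _) _; rewrite [e]splitr lerD //.
  apply: le_trans ((contm m).2 _) _.
  by move: xy; rewrite -ball_normE => /ltW.
- rewrite (_ : (fun _ => _) = cst 0); first exact: cvg_cst.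
  by apply/funext => m; rewrite contraction0.
- rewrite (_ : (fun _ => _) =
    (fun m => a *: iter m T x) + (fun m => iter m T y)).
    have := cvgD (cvgZl_tmp (k := a) Tx) Ty; rewrite scaler0 addr0. apply.
  by apply/funext => m; rewrite (contm m).1.
Qed.

(** * Largest invariant subset of a given set *)

Section Core.
Variables (I : Type) (A : I -> H -> H).

Definition invariant_under M := forall i, maps_to M (A i).

(** Quantifying over words presents this set as an intersection of preimages of [P] under
    contractions, so that it inherits closedness and linearity from [P]. *)
Definition core (P : set H) := [set x | forall w : seq I, P (foldr A x w)].

Lemma core_sub P : core P `<=` P.
Proof. by move=> x /(_ [::]). Qed.

Lemma core_invariant P : invariant_under (core P).
Proof.
(* [foldr] applies the last letter first, so acting by [A i] beforehand appends [i] at the end. *)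
move=> i x cx w; have := cx (rcons w i).
by rewrite -cats1 foldr_cat.
Qed.

Lemma core_max P M : invariant_under M -> M `<=` P -> M `<=` core P.
Proof.
move=> Minv MP x Mx w; apply: MP; elim: w => //= i w IH; exact: Minv.
Qed.

Hypothesis contA : forall i, linear_contraction (A i).

Lemma word_contraction w : linear_contraction (foldr A ^~ w).
Proof.
elim: w => [|i w [IHl IHn]] /=; first by split.
split => [a x y|x] /=; first by rewrite IHl (contA i).1.
exact: le_trans ((contA i).2 _) (IHn _).
Qed.

Lemma core_closed P : closed_subspace P -> closed_subspace (core P).
Proof.
move=> [Pc [P0 PP]]; have cw := word_contraction.
have {}P0 : P 0 := set_mem P0.
apply: closed_subspaceI => [||a x y cx cy w].
- rewrite (_ : core P = \bigcap_(w in setT) ((foldr A ^~ w) @^-1` P)).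
    apply: closed_bigI => w _; apply: closed_comp => //.
    by move=> x _; exact: linear_contraction_continuous.
  by apply/seteqP; split => x cx w; [move=> _|]; exact: cx.
- by move=> w; rewrite (contraction0 (cw w)).
- rewrite (cw w).1; apply: set_mem.
  exact: (PP a _ _ (mem_set (cx w)) (mem_set (cy w))).
Qed.

End Core.

End Adjoints.

(** * Unitary and shift parts of a single isometry *)

Section OneIsometry.
Local Open Scope complex_scope.
Variables (R : realType) (H : hilbertType R).
Variables (T : {linear H -> H}) (S : H -> H).
Hypotheses (isoT : forall x, `|T x| = `|x|) (TS : adjoint T S).
Implicit Types (x y z : H) (K M : set H).

Let contT : linear_contraction T := isometry_contraction isoT.
Let contS : linear_contraction S := adjoint_contraction contT TS.
Let TK : cancel T S := isometry_adjointK isoT TS.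

(** Pointwise forms of the two types. [S (T x) = x] holds for every isometry, so [T (S x) = x] is
    what remains of unitarity. *)
Definition type_set (t : op_type) : set H :=
  match t with
  | A_u => [set x | T (S x) = x]
  | A_shift => [set x | (fun m => iter m S x) @ \oo --> (0 : H)]
  end.

Lemma type_set_closed t : closed_subspace (type_set t).
Proof.
case: t; last exact: closed_iter_cvg0.
apply: (@closed_eq_contraction _ _ (T \o S)); split => [a x y|x] /=.
  by rewrite contS.1 contT.1.
exact: le_trans (contT.2 _) (contS.2 _).
Qed.

(** The adjoint quantified inside [of_type_on] agrees with [S] on [M] by uniqueness, so the type can
    be tested with [S]. *)
Lemma of_type_onP M t : closed_subspace M -> maps_to M T -> maps_to M S ->
  of_type_on M T t <-> M `<=` type_set t.
Proof.
move=> Mc MT MS.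
have adjM : adjoint_on M T S by split => // x y _ _; exact: TS.
have Sunique S' : adjoint_on M T S' -> forall y, M y -> S' y = S y.
  by move=> TS'; apply: (adjoint_on_unique Mc TS').
case: t => /=; split.
- move=> [_ [S' /Sunique S'E S'K]] x Mx /=.
  by rewrite -S'E // (S'K _ Mx).2.
- by move=> MP; split => //; exists S => // x Mx; split => //; apply: MP.
- move=> [_ [S' /Sunique S'E S'0]] x Mx /=.
  have /= := S'0 _ Mx; rewrite (_ : (fun _ => _) = (fun m => iter m S x)) //.
  apply/funext => m; suff : M (iter m S x) /\ iter m S' x = iter m S x by case.
  elim: m => //= m [Mm ->]; split; [exact: MS|exact: S'E].
- by move=> MP; split; [split|exists S].
Qed.

Lemma type_sets_orthogonal L M : maps_to L S -> maps_to M S ->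
  L `<=` type_set A_u -> M `<=` type_set A_shift -> orthogonal_sets L M.
Proof.
move=> LS MS LP MP x y Lx My.
have step m : L (iter m S x) /\ <|iter m S x, iter m S y|> = <|x, y|>.
  elim: m => //= m [Lm <-]; split; first exact: LS.
  by rewrite -TS LP.
apply/eqP; rewrite -normr_le0; apply/ler_addgt0Pl => e e0; rewrite addr0.
have ex : 0 < e / (`|x| + 1) by rewrite divr_gt0 // ltr_wpDl.
have /cvgr0Pnorm_le/(_ _ ex)[N _ /(_ N (leqnn N)) /= yN] := MP _ My.
rewrite -(step N).2; apply: le_trans (cauchy_schwarz _ _) _.
have xN := (linear_contraction_iter contS N).2 x.
apply: (@le_trans _ _ ((`|x| + 1) * (e / (`|x| + 1)))).
  by apply: ler_pM => //; apply: le_trans xN _; rewrite lerDl.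
by rewrite mulrC divfK // gt_eqF // ltr_wpDl.
Qed.

Lemma iter_isometryK m : cancel (iter m T) (iter m S).
Proof. by elim: m => // m IH x; rewrite iterSr /= TK. Qed.

Lemma iter_isometry_norm m x : `|iter m T x| = `|x|.
Proof. by elim: m => //= m IH; rewrite isoT. Qed.

(** [iter m T (iter m S x)] is the projection of [x] onto the range of the [m]-th power of [T].
    These ranges decrease, so after [iter m T] is factored out the claim is Pythagoras for [y] and
    its projection [p]. *)
Lemma range_projection_dist m k x : (m <= k)%N ->
  `|iter m T (iter m S x) - iter k T (iter k S x)| ^+ 2 =
  `|iter m S x| ^+ 2 - `|iter k S x| ^+ 2.
Proof.
move=> /subnK <-; set j := (k - m)%N.
have TE v : iter (j + m) T v = iter m T (iter j T v) by rewrite addnC iterD.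
rewrite TE iterD; set y := iter m S x.
have contTm := linear_contraction_iter contT.
rewrite -(contractionB (contTm m)) iter_isometry_norm.
set p := iter j T (iter j S y); have pE : `|iter j S y| = `|p|.
  by rewrite iter_isometry_norm.
have orth : <|y - p, p|> = 0.
  have adj i : adjoint (iter i T) (iter i S).
    elim: i => [//|i IH] u v; rewrite iterS TS IH.
    by rewrite -iterSr.
  apply: inner_eq0C; rewrite adj.
  rewrite (contractionB (linear_contraction_iter contS j)).
  by rewrite iter_isometryK subrr linear0r.
rewrite pE (_ : `|y| ^+ 2 = `|y - p| ^+ 2 + `|p| ^+ 2) ?addrK //.
by rewrite -sqr_normD_orth // subrK.
Qed.

(** The squared norms [a m] decrease to a limit, so by [range_projection_dist] the projections [p m]
    are Cauchy. Their limit lies in the image of [M] under every power of [T], hence is 0, and [p m]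
    has the norm of [iter m S x]. *)
Lemma type_shift_of_unitary_part0 M :
  closed_subspace M -> maps_to M T -> maps_to M S ->
  (forall z, M z -> (forall m, exists2 y, M y & z = iter m T y) -> z = 0) ->
  M `<=` type_set A_shift.
Proof.
move=> [Mc _] MT MS M0 x Mx /=.
have Miter F y m : maps_to M F -> M y -> M (iter m F y).
  by move=> MF My; elim: m => //= m; apply: MF.
pose p m := iter m T (iter m S x).
pose a m := complex.Re (`|iter m S x| ^+ 2 : R[i]).
have aE m : `|iter m S x| ^+ 2 = (a m)%:C.
  by rewrite /a RRe_real // rpredX ?normr_real.
have a_ge0 m : 0 <= a m by rewrite -lecR -aE exprn_ge0.
have a_ni : nonincreasing_seq a.
  move=> m k mk; rewrite -lecR -!aE -subr_ge0 -range_projection_dist //.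
  by rewrite exprn_ge0.
have a_lb : has_lbound (range a) by exists 0 => _ [m _ <-].
have a_cvg := nonincreasing_cvgn a_ni a_lb.
set d := inf _ in a_cvg.
have a_ge m : d <= a m by apply: ge_inf => //; exists m.
have /cvg_ex[l pl] : cvg (p @ \oo).
  apply: (@cvg_sqr_dist _ _ _ (fun m => a m - d)) => [|m k mk].
    by rewrite -(subrr d); apply: cvgB => //; exact: cvg_cst.
  rewrite range_projection_dist // !aE -rmorphB /= lecR.
  by have := a_ge m; have := a_ge k; lra.
have Ml : M l.
  have Mp m : M (p m) by apply: (Miter T) => //; apply: (Miter S).
  by apply: (closed_cvg M Mc _ _ pl); apply: nearW.
have lE m : iter m T (iter m S l) = l.
  have contm : linear_contraction (iter m T \o iter m S).
    have cT := linear_contraction_iter contT m.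
    have cS := linear_contraction_iter contS m.
    split => [b u v|u] /=; first by rewrite cS.1 cT.1.
    exact: le_trans (cT.2 _) (cS.2 _).
  (* From index [m] on, [p k] is in the range of [iter m T] and so is fixed by the projection onto
     it; the fixed vectors form a closed set. *)
  apply: (closed_cvg _ (closed_eq_contraction contm).1 _ _ pl).
  exists m => // k /= mk; rewrite /p -(subnKC mk) (iterD m _ T).
  by rewrite iter_isometryK.
have l0 : l = 0.
  by apply: M0 => // m; exists (iter m S l); [exact: (Miter S)|rewrite lE].
apply: norm_cvg0; rewrite l0 in pl.
move/norm_cvg0P : pl; rewrite (_ : (fun _ => _) = (fun m => `|iter m S x|)) //.
by apply/funext => m; rewrite /p iter_isometry_norm.
Qed.

End OneIsometry.

(** * Joint reducing subspaces of a tuple and their typed parts *)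

Section Tuple.
Variables (R : realType) (H : hilbertType R) (n : nat).
Variables (V : 'I_n -> bounded_operator H).
Variables (Q : 'I_n -> 'I_n -> bounded_operator H).
Variables (Vs : 'I_n -> H -> H).
Hypothesis QV : Q_commuting_on setT V Q.
Hypothesis isoV : forall i x, `|V i x| = `|x|.
Hypothesis VVs : forall i, adjoint (V i) (Vs i).
Implicit Types (x y z : H) (K M : set H) (theta : 'I_n -> op_type).

Lemma closed_subspaceT : closed_subspace (@setT H).
Proof. by apply: closed_subspaceI => //; exact: closedT. Qed.

Lemma Q_adjoint i j : i != j -> adjoint (Q i j) (Q j i).
Proof.
case: QV => _ QU _ _ _; rewrite eq_sym => /QU[_ [_ adjQ]] x y; exact: adjQ.
Qed.

(** The inverse supplied by unitarity is an adjoint of [Q i j], hence equals [Q j i]. *)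
Lemma Q_cancel i j : i != j -> cancel (Q i j) (Q j i).
Proof.
move=> ij x; case: QV => _ /(_ _ _ ij)[[_ [S QS SK] _]] _ _ _.
rewrite -(adjoint_on_unique closed_subspaceT QS (Q_adjoint ij)) //.
by case: (SK x).
Qed.

Lemma Q_isometry i j x : i != j -> `|Q i j x| = `|x|.
Proof.
move=> ij; apply/eqP; rewrite -(@eqrXn2 _ 2) //.
by rewrite !sqr_norm_inner Q_adjoint // Q_cancel.
Qed.

Lemma V_Q_comm i j k x : i != j -> V k (Q i j x) = Q i j (V k x).
Proof. by case: QV => _ _ _ _ VQ ij; apply: VQ. Qed.

Lemma V_V_comm i j x : i != j -> V i (V j x) = Q i j (V j (V i x)).
Proof. by case: QV => _ _ _ VV _ ij; apply: VV. Qed.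

Lemma Vs_Q_comm i j k x : i != j -> Vs k (Q i j x) = Q i j (Vs k x).
Proof.
move=> ij; apply: inner_inj => y; have ji : j != i by rewrite eq_sym.
by rewrite (adjoint_sym (VVs k)) !Q_adjoint // (adjoint_sym (VVs k)) V_Q_comm.
Qed.

Definition letter : Type := 'I_n + 'I_n + 'I_n * 'I_n.

(* The letters are the operators [V i], their adjoints and the [Q i j]; the
   unused diagonal entries [Q i i] are replaced by the identity. *)
Definition letter_op (l : letter) : H -> H :=
  match l with
  | inl (inl i) => V i
  | inl (inr i) => Vs i
  | inr (i, j) => if i == j then id else Q i j
  end.

Definition letter_star (l : letter) : letter :=
  match l with
  | inl (inl i) => inl (inr i)
  | inl (inr i) => inl (inl i)
  | inr (i, j) => inr (j, i)
  end.

Lemma letter_adjoint l : adjoint (letter_op l) (letter_op (letter_star l)).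
Proof.
case: l => [[i|i]|[i j]] /=; [exact: VVs|exact/adjoint_sym/VVs|].
by rewrite eq_sym; case: eqVneq => // ji; apply: Q_adjoint; rewrite eq_sym.
Qed.

Lemma letter_contraction l : linear_contraction (letter_op l).
Proof.
have cV i := isometry_contraction (isoV i).
case: l => [[i|i]|[i j]] /=; [exact: cV|exact: adjoint_contraction (VVs i)|].
case: eqVneq => [_|ij]; first by split.
by apply: isometry_contraction => x; exact: Q_isometry.
Qed.

Notation jinvariant := (invariant_under letter_op).

(** The adjoint of a letter is again a letter, so invariance of [M] passes to its orthocomplement in
    [K]. *)
Lemma invariant_joint_reducing K M : jinvariant K -> jinvariant M ->
  closed_subspace M -> M `<=` K -> joint_reducing_on K V Q M.
Proof.
move=> Kinv Minv Mc MK.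
have red l : reduces_on K (letter_op l) M.
  split => //.
  apply: maps_ominus (letter_adjoint l) _ _; [exact: Kinv|exact: Minv].
split => // [i|i j ij]; first exact: red (inl (inl i)).
by have := red (inr (i, j)); rewrite /= (negPf ij).
Qed.

Lemma joint_reducing_invariant K M : closed_subspace K -> jinvariant K ->
  joint_reducing_on K V Q M -> jinvariant M.
Proof.
move=> Kc Kinv [_ redV redQ] [[i|i]|[i j]] /=.
- by case: (redV i).
- apply: reduces_maps_adjoint Kc (VVs i) _ (redV i).
  exact: (Kinv (inl (inr i))).
- by case: eqVneq => [_ x //|ij]; case: (redQ _ _ ij).
Qed.

Lemma invariantT : jinvariant setT.
Proof. by []. Qed.

Lemma joint_reducingTP M : joint_reducing_on setT V Q M <->
  closed_subspace M /\ jinvariant M.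
Proof.
split => [MR|[Mc Minv]]; last exact: invariant_joint_reducing.
split; first by case: MR => -[].
exact: joint_reducing_invariant closed_subspaceT invariantT MR.
Qed.

Lemma invariant_ominus M : jinvariant M -> jinvariant (ominus setT M).
Proof.
move=> Minv l; apply: maps_ominus (letter_adjoint l) _ _ => //; exact: Minv.
Qed.

Lemma ominus_closed M : closed_subspace (ominus setT M).
Proof.
apply: closed_subspaceI => [||a x y [_ xM] [_ yM]].
- rewrite (_ : ominus _ _ =
    \bigcap_(y in M) ((fun x => <|x, y|> : (R[i])^o) @^-1` [set 0])).
    apply: closed_bigI => y _; apply: closed_comp.
      by move=> x _; exact: inner_continuousl.
    exact: closed_singleton.
  by apply/seteqP; split => x /= => [[_ xM] y|xM]; [exact: xM|split].
- by split => // y _; exact: linear0l.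
- by split => // z Mz; rewrite linearDl /= innerZl xM // yM // mulr0 addr0.
Qed.

Definition tuple_type_set theta : set H :=
  \bigcap_(k in setT) type_set (V k) (Vs k) (theta k).

Definition typed_part theta := core letter_op (tuple_type_set theta).

Lemma typed_part_closed theta : closed_subspace (typed_part theta).
Proof.
apply: core_closed; first exact: letter_contraction.
have tc k := type_set_closed (isoV k) (VVs k) (theta k).
apply: closed_subspaceI => [|k _|a x y Px Py k _].
- by apply: closed_bigI => k _; case: (tc k).
- by case: (tc k) => _ [P0 _]; exact: set_mem P0.
- case: (tc k) => _ [_ P]; apply: set_mem.
  exact: (P a x y (mem_set (Px k I)) (mem_set (Py k I))).
Qed.

Lemma typed_part_invariant theta : jinvariant (typed_part theta).
Proof. exact: core_invariant. Qed.

Lemma joint_reducing_of_typeP theta M :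
  joint_reducing_of_type V Q theta M <->
  [/\ closed_subspace M, jinvariant M & M `<=` tuple_type_set theta].
Proof.
have onP k : closed_subspace M -> jinvariant M ->
    of_type_on M (V k) (theta k) <-> M `<=` type_set (V k) (Vs k) (theta k).
  move=> Mc Minv; apply: of_type_onP => //.
  - exact: (Minv (inl (inl k))).
  - exact: (Minv (inl (inr k))).
split => [[/joint_reducingTP[Mc Minv] MT]|[Mc Minv MT]].
  by split => // x Mx k _; move: x Mx; apply/onP.
split; first exact/joint_reducingTP.
by move=> k; apply/onP => // x Mx; exact: MT.
Qed.

Lemma typed_part_of_type theta :
  joint_reducing_of_type V Q theta (typed_part theta).
Proof.
apply/joint_reducing_of_typeP; split.
- exact: typed_part_closed.
- exact: typed_part_invariant.
- exact: core_sub.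
Qed.

Lemma typed_part_max theta M :
  joint_reducing_of_type V Q theta M -> M `<=` typed_part theta.
Proof. by move=> /joint_reducing_of_typeP[_ Minv MT]; apply: core_max. Qed.

(** The part contains every joint reducing subspace of its type, so maximality forces equality. *)
Lemma typed_part_maximal theta :
  maximal_joint_reducing_of_type V Q theta (typed_part theta) /\
  forall M, maximal_joint_reducing_of_type V Q theta M -> M = typed_part theta.
Proof.
split=> [|M [MT Mmax]].
  split; first exact: typed_part_of_type.
  by move=> M MT sub; apply/seteqP; split => //; exact: typed_part_max.
by apply/esym/Mmax; [exact: typed_part_of_type|exact: typed_part_max].
Qed.

Lemma typed_part_orthogonal theta theta' k :
  theta k = A_u -> theta' k = A_shift ->
  orthogonal_sets (typed_part theta) (typed_part theta').
Proof.
move=> tk tk'; apply: (type_sets_orthogonal (isoV k) (VVs k)).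
- exact: (typed_part_invariant (inl (inr k))).
- exact: (typed_part_invariant (inl (inr k))).
- by move=> x /core_sub/(_ k I); rewrite tk.
- by move=> x /core_sub/(_ k I); rewrite tk'.
Qed.

(** For a closed joint reducing [M], this is the unitary summand in the Wold decomposition of [V k]
    restricted to [M]. *)
Definition range_part M k :=
  [set x | M x /\ forall m, exists2 y, M y & x = iter m (V k) y].

(* For [i != k] the letters at [i] map the range of [V_k^m] on [M] into itself
   because they commute with [V_k] up to a [Q]; for [V_i^*] this uses that [V_i]
   is unitary on [M]. *)
Lemma range_part_invariant M k : jinvariant M ->
  (forall i, i != k -> M `<=` type_set (V i) (Vs i) A_u) ->
  jinvariant (range_part M k).
Proof.
move=> Minv MU.
have MV i : maps_to M (V i) by exact: (Minv (inl (inl i))).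
have MVs i : maps_to M (Vs i) by exact: (Minv (inl (inr i))).
have MQ i j : i != j -> maps_to M (Q i j).
  by move=> ij; have := Minv (inr (i, j)); rewrite /= (negPf ij).
have Miter m y : M y -> M (iter m (V k) y).
  by move=> My; elim: m => //= m; apply: MV.
pose stable (T : H -> H) := forall m y, M y ->
  exists2 y', M y' & T (iter m (V k) y) = iter m (V k) y'.
have stableQ i j : i != j -> stable (Q i j).
  move=> ij m y My; exists (Q i j y); first exact: MQ.
  by elim: m => //= m <-; rewrite V_Q_comm.
(* Each passage of [T] across one [V k] costs a factor [Q i j], which [stableQ] then moves inside
   the power of [V k]. *)
have stable_twist (T : H -> H) i j : i != j -> maps_to M T ->
    (forall y, M y -> T (V k y) = Q i j (V k (T y))) -> stable T.
  move=> ij MT TV; elim => [|m IH] y My; first by exists (T y) => //; exact: MT.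
  rewrite iterS TV; last exact: Miter.
  have [y' My' ->] := IH y My.
  have [z Mz zE] := stableQ _ _ ij m.+1 _ My'.
  by exists z.
have sub T : maps_to M T -> stable T -> maps_to (range_part M k) T.
  move=> MT sT x [Mx xr]; split; first exact: MT.
  by move=> m; have [y My ->] := xr m; exact: sT.
case=> [[i|i]|[i j]] /=.
- have [->|ik] := eqVneq i k; last first.
    by apply/sub/(stable_twist _ i k) => // y My; rewrite V_V_comm.
  move=> x [Mx xr]; split; first exact: MV.
  move=> m; have [y My ->] := xr m; exists (V k y); first exact: MV.
  by rewrite -iterS iterSr.
- have [->|ik] := eqVneq i k.
    move=> x [Mx xr]; split; first exact: MVs.
    (* One power more than required is taken, because the adjoint cancels one. *)
    move=> m; have [y My ->] := xr m.+1; exists y => //=.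
    by rewrite (isometry_adjointK (isoV k) (VVs k)).
  have ki : k != i by rewrite eq_sym.
  apply/sub/(stable_twist _ k i) => // y My.
  (* Inserting [V i (Vs i y)] lets [V k] cross [V i], after which the outer [Vs i] cancels [V i]. *)
  have yE : y = V i (Vs i y) by rewrite (MU i).
  rewrite {1}yE.
  have -> : V k (V i (Vs i y)) = Q k i (V i (V k (Vs i y))) by rewrite V_V_comm.
  by rewrite Vs_Q_comm // (isometry_adjointK (isoV i) (VVs i)).
- case: eqVneq => [_|ij]; first by move=> x.
  by apply: sub; [exact: MQ|exact: stableQ].
Qed.

End Tuple.

(** * Types with at most one shift, and their numbering *)

Lemma card_ge_predn_eq n (P : pred 'I_n) i j :
  (n.-1 <= #|P|)%N -> ~~ P i -> ~~ P j -> i = j.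
Proof.
move=> nP iP jP; suff /card_le1_eqP h : (#|[predC P]| <= 1)%N.
  by apply: h; rewrite inE.
rewrite -(leq_add2l #|P|) cardC card_ord addn1.
exact: leq_trans (leqSpred n) _.
Qed.

Section ThetaIndex.
Variable n : nat.
Implicit Types (theta : 'I_n -> op_type) (j : 'I_n.+1) (k : 'I_n).

(* Index 0 stands for the all-unitary type, index k + 1 for the type whose only
   shift is at k. *)
Definition theta_of j k := if j == lift ord0 k then A_shift else A_u.

Definition index_of theta :=
  if [pick k | ~~ is_A_u (theta k)] is Some k then lift ord0 k else ord0.

Lemma is_A_u_theta_of j k : is_A_u (theta_of j k) = (j != lift ord0 k).
Proof. by rewrite /theta_of; case: eqP. Qed.

Lemma theta_ofK j : index_of (theta_of j) = j.
Proof.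
rewrite /index_of; case: pickP => [k|none].
  by rewrite is_A_u_theta_of negbK => /eqP.
case: (unliftP ord0 j) => // k jk.
by have := none k; rewrite is_A_u_theta_of negbK jk eqxx.
Qed.

Lemma theta_of_Theta j : Theta n (theta_of j).
Proof.
rewrite /Theta /= (eq_card (B := [pred k | j != lift ord0 k])); last first.
  by move=> k; rewrite !inE is_A_u_theta_of.
rewrite -[in n.-1](card_ord n) -(cardC [pred k | j != lift ord0 k]).
rewrite -subn1 leq_subLR addnC leq_add2r; apply/card_le1_eqP => k l.
rewrite !inE !negbK => /eqP jk /eqP jl.
by apply: (@lift_inj _ ord0); rewrite -jk -jl.
Qed.

(** A type in [Theta n] has at most one shift, so the position picked by [index_of] determines
    it. *)
Lemma index_ofK theta : Theta n theta -> theta_of (index_of theta) = theta.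
Proof.
move=> Ttheta; apply/funext => k; rewrite /theta_of /index_of.
case: pickP => [l lP|/(_ k)]; last first.
  by rewrite -[_ == _]/false; case: (theta k).
have [/lift_inj <-|lk] := eqVneq; first by case: (theta l) lP.
case tk : (theta k) => //; case/eqP: lk; congr lift.
by apply: (card_ge_predn_eq Ttheta); rewrite //= tk.
Qed.

End ThetaIndex.

(** * Assembly of the decomposition *)

Theorem theorem5p7 (R : realType) (H : hilbertType R) (n : nat) (n_gt0 : (0 < n)%N)
    (V : 'I_n -> bounded_operator H)
    (Q : 'I_n -> 'I_n -> bounded_operator H)
    (QV : Q_commuting_on setT V Q)
    (isoV : forall i, isometry_on setT (V i)) :
  exists (Hs : set H) (H_ : 'I_n.+1 -> set H),
    orthogonal_decomposition Hs H_ /\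
    [/\ joint_reducing_on setT V Q Hs /\
          (forall j, joint_reducing_on setT V Q (H_ j)),
        forall (i : 'I_n) (j : 'I_n.+1),
          unitary_on (H_ j) (V i) \/ pure_isometry_on (H_ j) (V i),
        exists2 t : ('I_n -> op_type) -> 'I_n.+1,
          set_bij (Theta n) setT t &
          forall theta, Theta n theta ->
            maximal_joint_reducing_of_type V Q theta (H_ (t theta)) /\
            forall M, maximal_joint_reducing_of_type V Q theta M ->
              M = H_ (t theta) &
        strongly_pure_on Hs V Q].
Proof.
have isoV' i x : `|V i x| = `|x| by case: (isoV i) => _; apply.
have /choice[Vs VVs] i : exists S, adjoint (V i) S.
  exact: isometry_adjoint_exists (isoV' i).
pose H_ j := typed_part V Q Vs (theta_of j).
pose Hs := ominus setT (\bigcup_(j in setT) H_ j).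
have Hc j : closed_subspace (H_ j) by exact: typed_part_closed.
have Hinv j : invariant_under (letter_op V Q Vs) (H_ j).
  exact: typed_part_invariant.
have Hsc : closed_subspace Hs by exact: ominus_closed.
have Hsinv : invariant_under (letter_op V Q Vs) Hs.
  (* The union of the [H_ j] need not be a subspace; its invariance under the letters suffices. *)
  by apply: invariant_ominus => // l x [j _ xj]; exists j => //; exact: Hinv.
have Hs_orth j x y : Hs x -> H_ j y -> <|x, y|> = 0.
  by move=> [_ xP] Hy; apply: xP; exists j.
have H_orth j k : j != k -> orthogonal_sets (H_ j) (H_ k).
  (* Of two distinct indices one is nonzero, and orthogonality is symmetric. At position [l] the
     type of [k] is a shift and that of [j] is unitary. *)
  wlog [l kl] : j k / exists l, k = lift ord0 l.
    move=> wl; case: (unliftP ord0 k) => [l|] k0 jk.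
      by apply: wl => //; exists l.
    case: (unliftP ord0 j) => [l|] j0; last by rewrite j0 k0 eqxx in jk.
    move=> x y xj yk; apply: inner_eq0C.
    by apply: (wl k j) => //; [exists l|rewrite eq_sym].
  move=> jk; apply: (@typed_part_orthogonal _ _ _ _ _ _ isoV' VVs _ _ l).
    by rewrite /theta_of -kl (negPf jk).
  by rewrite /theta_of -kl eqxx.
have HsH0 j x : Hs x -> H_ j x -> x = 0.
  move=> xs xj; apply/eqP; rewrite -(dnorm_eq0 (@inner _ H)).
  by rewrite (Hs_orth j).
exists Hs, H_; split; last split.
- split=> // x.
  have /choice[z zP] j : exists y,
      H_ j y /\ forall h, H_ j h -> <|x - y, h|> = 0.
    by have [y] := projection_exists x (Hc j); exists y.
  (* Tested against [H_ j], the residual loses [x - z j] by projection and every other [z i] by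
     mutual orthogonality. *)
  exists (x - \sum_j z j), z; split; last by rewrite subrK.
    split => // h [j _ hj]; rewrite (bigD1 j) //= opprD addrA linearBl /=.
    rewrite (zP j).2 // linear_sumlz big1 ?subrr // => i ij.
    exact: (H_orth i j ij _ _ (zP i).1).
  by move=> j; case: (zP j).
- split=> [|j]; first exact/joint_reducingTP.
  exact/joint_reducingTP.
- move=> i j; have [_ /(_ i)] := typed_part_of_type QV isoV' VVs (theta_of j).
  by case: (theta_of j i); [left|right].
- exists (@index_of n).
    split => [//|s t|j _].
      move=> /set_mem sT /set_mem tT st.
      by rewrite -(index_ofK sT) st index_ofK.
    by exists (theta_of j); [exact: theta_of_Theta|exact: theta_ofK].
  move=> theta /index_ofK thetaE; rewrite /H_ thetaE.
  exact: typed_part_maximal.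
split.
- have sub i j : i != j -> maps_to Hs (Q i j).
    by move=> ij; have := Hsinv (inr (i, j)); rewrite /= (negPf ij).
  have adj i j : i != j -> adjoint_on Hs (Q i j) (Q j i).
    move=> ij; split => [|x y _ _]; first by apply: sub; rewrite eq_sym.
    exact: (Q_adjoint QV).
  case: (QV) => _ _ QQ VV VQ; split.
  + by move=> i; exact: (Hsinv (inl (inl i))).
  + move=> i j ij; have ji : j != i by rewrite eq_sym.
    split; last exact: adj.
    split; first exact: sub.
    exists (Q j i); first exact: adj.
    by move=> x _; split; exact: (Q_cancel QV).
  + by move=> i j k l ij kl x _; apply: QQ.
  + by move=> i j ij x _; apply: VV.
  + by move=> i j k ij x _; apply: VQ.
- by move=> i; split => // ; exact: (Hsinv (inl (inl i))).
move=> M MR MU.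
have Minv : invariant_under (letter_op V Q Vs) M.
  exact: joint_reducing_invariant MR.
have [[Mc MHs] _ _] := MR.
(* [k] is the only possible non-unitary position; if all are unitary, any index serves, and
   positivity of [n] provides one. *)
have [k kP] : exists k, forall i, i != k -> unitary_on M (V i).
  pose P := [pred i | `[< unitary_on M (V i) >]].
  have [k kP|allP] := pickP [predC P].
    exists k => i; apply: contra_neqP => iP.
    apply: (card_ge_predn_eq MU) => //=.
    by apply/asboolPn.
  exists (Ordinal n_gt0) => i _.
  by have := allP i; rewrite /= => /negbFE/asboolP.
have MV i : maps_to M (V i) by exact: (Minv (inl (inl i))).
have MVs i : maps_to M (Vs i) by exact: (Minv (inl (inr i))).
have Mu i : i != k -> M `<=` type_set (V i) (Vs i) A_u.
  by move=> /kP; apply: (of_type_onP (isoV' i) (VVs i) A_u Mc _ _).1.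
have M_range x : range_part V M k x -> x = 0.
  move=> xr; apply: (HsH0 ord0); first by apply: MHs; case: xr.
  have rinv := range_part_invariant QV isoV' VVs Minv Mu.
  (* The range part is invariant and every [V i] is unitary on it, so it lies in the all-unitary
     summand, which meets [Hs] only in 0. *)
  apply: (core_max rinv) xr => {}x [Mx xr] i _.
  rewrite /theta_of -[_ == _]/false.
  have [->|ik] := eqVneq i k; last exact: (Mu i).
  by have [y _ ->] := xr 1%N; rewrite /= (isometry_adjointK (isoV' k) (VVs k)).
have Mshift : M `<=` type_set (V k) (Vs k) A_shift.
  apply: (type_shift_of_unitary_part0 (isoV' k) (VVs k)) => // z Mz zr.
  exact: M_range.
apply/seteqP; split => [x Mx|_ ->]; last first.
  by case: Mc => _ /submod_closedP[].
(* [M] now has the type whose only shift is at [k], so it lies in the corresponding summand as well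
   as in [Hs]. *)
apply: (HsH0 (lift ord0 k)); first exact: MHs.
apply: (core_max Minv) Mx => {}x Mx i _.
rewrite /theta_of (inj_eq lift_inj).
by case: eqVneq => [<-|ki]; [exact: Mshift|apply: (Mu i) => //; rewrite eq_sym].
Qed.
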